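(* Let $w \ge 1$ be an integer and $J_m = (2^m-(-1)^m)/3$. For every integer $N$ with $J_{w+1} < N \le J_{w+2}$ we have $f(N) = w$, and for every integer $N$ with $J_w < N \le J_{w+1}$ we have $r(N) = w$.
   Context: Setting (alternator coin problem): There are $N$ identical-looking coins. All but one are real and have the same weight. The remaining coin, the alternator, behaves as follows: each time it is placed on a balance scale it weighs either the same as a real coin (''acts real'') or strictly less than a real coin (''acts fake''), and it switches between these two behaviours every time it is on the scale; while off the scale its behaviour does not change. A weighing places two disjoint sets of coins with the same number of coins on the two pans, and its outcome is one of: the pans balance, the left pan is lighter, or the right pan is lighter. Weighings may be chosen adaptively based on earlier outcomes. A strategy finds the alternator if, for every possible identity of the alternator, the outcomes determine which coin it is. The alternator is in the $f$-state if the next time it is on the scale it will act fake, and in the $r$-state if the next time it is on the scale it will act real. $f(N)$ (resp. $r(N)$) is the smallest number of weighings that guarantees finding the alternator among $N$ coins when it starts in the $f$-state (resp. $r$-state). $J_m=(2^m-(-1)^m)/3$ is the $m$-th Jacobsthal number ($J_0=0,J_1=1,J_2=1,J_3=3,J_4=5,\dots$). *)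

(* Defs.v *)
From HB Require Import structures.
From mathcomp Require Import all_boot all_order all_algebra.

Set Implicit Arguments.
Unset Strict Implicit.
Unset Printing Implicit Defensive.

Import Order.TTheory GRing.Theory Num.Theory.

Definition jacobsthal (m : nat) : rat := ((2 ^+ m - (-1) ^+ m) / 3)%R.

(* FState: the alternator acts fake the next time it is on the scale;
   RState: it acts real the next time it is on the scale. *)
Inductive state := FState | RState.

Definition switch (st : state) : state :=
  match st with FState => RState | RState => FState end.

Inductive outcome := Balance | LeftLighter | RightLighter.

Record weighing (N : nat) := Weighing {
  lpan : {set 'I_N};
  rpan : {set 'I_N};
  pans_disjoint : [disjoint lpan & rpan];
  pans_same_card : #|lpan| = #|rpan|
}.

(* Both pans hold the same number of coins and only the alternator acting fake
   is lighter than a real coin, so the pan holding it is the lighter one; in all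
   other cases the pans balance. *)
Definition weigh_outcome (N : nat) (p : weighing N) (alt : 'I_N) (st : state)
  : outcome :=
  match st with
  | RState => Balance
  | FState => if alt \in lpan p then LeftLighter
              else if alt \in rpan p then RightLighter
              else Balance
  end.

Definition weigh_state (N : nat) (p : weighing N) (alt : 'I_N) (st : state)
  : state :=
  if alt \in lpan p :|: rpan p then switch st else st.

Inductive strategy (N : nat) :=
  | Stop
  | Weigh of weighing N & (outcome -> strategy N).

Fixpoint outcomes (N : nat) (s : strategy N) (alt : 'I_N) (st : state)
  : seq outcome :=
  match s with
  | Stop => [::]
  | Weigh p next =>
      let o := weigh_outcome p alt st in
      o :: outcomes (next o) alt (weigh_state p alt st)
  end.

Definition finds_alternator (N : nat) (st : state) (s : strategy N) : Prop :=
  forall alt alt' : 'I_N, outcomes s alt st = outcomes s alt' st -> alt = alt'.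

Definition uses_at_most (N : nat) (st : state) (s : strategy N) (w : nat)
  : Prop :=
  forall alt : 'I_N, size (outcomes s alt st) <= w.

Definition findable_within (st : state) (N w : nat) : Prop :=
  exists s : strategy N, finds_alternator st s /\ uses_at_most st s w.

Definition least_weighings (st : state) (N w : nat) : Prop :=
  findable_within st N w /\
  forall w' : nat, findable_within st N w' -> w <= w'.

(* "f(N) = w" and "r(N) = w" *)
Definition f_eq (N w : nat) : Prop := least_weighings FState N w.
Definition r_eq (N w : nat) : Prop := least_weighings RState N w.

(* Main.v *)
Require Import Defs.
From HB Require Import structures.
From mathcomp Require Import all_boot all_order all_algebra.
From mathcomp Require Import zify ring.

(** After an imbalance the alternator is in the r-state, so two imbalances are
    never consecutive; there are [J_(w+2)] words of length [w] over three
    outcomes with this property, and [J_(w+1)] of them begin with a balance.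
    This gives the lower bounds.  For the upper bounds, allow the state to
    depend on the coin.  From the f-state put [min (J_w, |F|/2)] coins of the
    candidate set [F] on each pan; from the r-state weigh all the candidates but
    at most one (according to parity), which moves them to the f-state.  The
    coin left out stays in the r-state, and the number of f-candidates then
    stays even until they are exhausted, so no known real coin is ever needed. *)

Set Implicit Arguments.
Unset Strict Implicit.
Unset Printing Implicit Defensive.

Import Order.TTheory GRing.Theory Num.Theory.

Lemma outcome_comparable : comparable outcome.
Proof. by move=> x y; rewrite /decidable; decide equality. Qed.
HB.instance Definition _ := hasDecEq.Build outcome (compareP outcome_comparable).

(** Given by its recurrence, which mirrors a weighing: one term for the balanced branch and twice
    the smaller term for the two imbalances. *)
Fixpoint jacobsthal_nat (m : nat) : nat :=
  match m with
  | 0 => 0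
  | 1 => 1
  | (m'.+1 as p).+1 => jacobsthal_nat p + 2 * jacobsthal_nat m'
  end.

Lemma jacobsthal_natSS m :
  jacobsthal_nat m.+2 = jacobsthal_nat m.+1 + 2 * jacobsthal_nat m.
Proof. by []. Qed.

Lemma jacobsthal_natE m : jacobsthal m = (jacobsthal_nat m)%:R%R.
Proof.
suff [] : jacobsthal m = (jacobsthal_nat m)%:R%R /\
          jacobsthal m.+1 = (jacobsthal_nat m.+1)%:R%R by [].
elim: m => [|m [IH0 IH1]]; first by split; rewrite /jacobsthal /=; field.
split=> //; rewrite jacobsthal_natSS natrD natrM -IH0 -IH1 /jacobsthal !exprS.
by field.
Qed.

Lemma jacobsthal_nat_gt0 m : 0 < jacobsthal_nat m.+1.
Proof. by elim: m => // m IH; rewrite jacobsthal_natSS; lia. Qed.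

Section Weighings.

Variable N : nat.
Implicit Types (p : weighing N) (s : strategy N) (st : 'I_N -> state).
Implicit Types (A B F R : {set 'I_N}) (w : nat).

(** Relative to a candidate set and a state for each coin, since a balance discards candidates and
    can leave the others in different states. *)
Definition identifies A st w s : Prop :=
  {in A &, injective (fun a => outcomes s a (st a))} /\
  {in A, forall a, size (outcomes s a (st a)) <= w}.

Definition state_after p st : 'I_N -> state :=
  fun a => weigh_state p a (st a).

Definition with_outcome p st A (o : outcome) : {set 'I_N} :=
  [set a in A | weigh_outcome p a (st a) == o].

Lemma identifies_next p next A st w o :
  identifies A st w.+1 (Weigh p next) ->
  identifies (with_outcome p st A o) (state_after p st) w (next o).
Proof.
move=> [inj sz]; split=> [a b|a]; last first.
  by rewrite inE => /andP[aA /eqP ao]; have := sz a aA; rewrite /= ao.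
rewrite !inE => /andP[aA /eqP ao] /andP[bA /eqP bo] eqab.
by apply: inj => //=; rewrite ao bo; congr cons.
Qed.

(** Only a coin acting fake on a pan causes an imbalance, and being on the scale switches it. *)
Lemma with_outcome_lighter p st A o :
  o <> Balance ->
  {in with_outcome p st A o, forall a, state_after p st a = RState}.
Proof.
move=> oB a; rewrite inE => /andP[_ /eqP].
rewrite /state_after /weigh_outcome /weigh_state in_setU.
by case: (st a) => [|/esym//]; do 2!case: ifP => _ //=; move/esym.
Qed.

Lemma card_with_outcome p st A :
  #|A| <= #|with_outcome p st A Balance| + #|with_outcome p st A LeftLighter|
          + #|with_outcome p st A RightLighter|.
Proof.
set B := with_outcome _ _ _ Balance; set L := with_outcome _ _ _ LeftLighter.
set R := with_outcome _ _ _ RightLighter.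
have sub : A \subset B :|: L :|: R.
  apply/subsetP => a aA; rewrite !inE aA !andTb.
  by case: weigh_outcome; rewrite eqxx ?orbT.
apply: leq_trans (subset_leq_card sub) (leq_trans (leq_card_setU _ _) _).
by rewrite leq_add2r leq_card_setU.
Qed.

Lemma card_identifies s w A st :
  identifies A st w s ->
  #|A| <= jacobsthal_nat w.+2 /\
  ({in A, forall a, st a = RState} -> #|A| <= jacobsthal_nat w.+1).
Proof.
elim: s w A st => [|p next IH] w A st ids.
  have A1 : #|A| <= 1 by apply/card_le1_eqP => a b aA bA; apply: ids.1.
  by split=> [|_]; apply: leq_trans A1 (jacobsthal_nat_gt0 _).
case: w ids => [|w] ids.
  (* A strategy that starts by weighing records an outcome, so budget [0] admits no candidate. *)
  have -> : A = set0.
    by apply/setP => a; rewrite inE; apply/negP => /ids.2.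
  by rewrite cards0.
have IHo o := IH o _ _ _ (identifies_next o ids).
split=> [|stR].
  apply: leq_trans (card_with_outcome p st A) _.
  rewrite [X in _ <= X]jacobsthal_natSS mul2n -addnn addnA.
  apply: leq_add; first apply: leq_add; first by have [] := IHo Balance.
  - by apply: (IHo LeftLighter).2; apply: with_outcome_lighter.
  - by apply: (IHo RightLighter).2; apply: with_outcome_lighter.
(* From the r-state the first weighing always balances: it costs one unit of budget and excludes
   nobody. *)
have {1}-> : A = with_outcome p st A Balance.
  apply/setP => a; rewrite inE; case: (boolP (a \in A)) => //= aA.
  by rewrite (stR a aA) eqxx.
by have [] := IHo Balance.
Qed.

(** * Construction of strategies *)

Definition identifiable A st w : Prop := exists s, identifies A st w s.

Lemma identifiable_sub A B st w :
  A \subset B -> identifiable B st w -> identifiable A st w.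
Proof.
move=> /subsetP AB [s [inj sz]]; exists s; split=> [a b aA bA|a aA].
  by apply: inj; apply: AB.
by apply: sz; apply: AB.
Qed.

Lemma identifiable_card_le1 A st w : #|A| <= 1 -> identifiable A st w.
Proof.
move=> /card_le1_eqP A1; exists (Stop N); split=> // a b aA bA _.
exact: A1.
Qed.

Lemma identifiable_weigh p A st w :
  (forall o, identifiable (with_outcome p st A o) (state_after p st) w) ->
  identifiable A st w.+1.
Proof.
move=> ids.
have [[sB idB] [sL idL] [sR idR]] := And3 (ids Balance) (ids LeftLighter) (ids RightLighter).
pose next o := match o with
  | Balance => sB | LeftLighter => sL | RightLighter => sR end.
have idn o : identifies (with_outcome p st A o) (state_after p st) w (next o).
  by case: o.
exists (Weigh p next); split=> [a b aA bA /= [oab eqab]|a aA /=]; last first.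
  by apply: (idn _).2; rewrite inE aA eqxx.
apply: (idn (weigh_outcome p a (st a))).1; rewrite ?inE ?aA ?bA ?eqxx //=.
  by rewrite oab.
by rewrite eqab -oab.
Qed.

Lemma exists_subset_card A n :
  n <= #|A| -> exists2 B : {set 'I_N}, B \subset A & #|B| = n.
Proof.
move=> /card_geqP[t [ut <- sub_tA]]; exists [set a in t].
  by apply/subsetP => a; rewrite inE; apply: sub_tA.
by rewrite cardsE; apply/card_uniqP.
Qed.

Lemma exists_weighing A n :
  n.*2 <= #|A| ->
  exists p, [/\ lpan p :|: rpan p \subset A, #|lpan p| = n & #|rpan p| = n].
Proof.
move=> leA; have [|L LA cL] := @exists_subset_card A n; first by lia.
have [|R RA cR] := @exists_subset_card (A :\: L) n.
  by rewrite cardsDS // cL; lia.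
have LR : [disjoint L & R].
  by rewrite disjoint_sym; move: RA; rewrite subsetD => /andP[].
exists (Weighing LR (etrans cL (esym cR))); split=> //=.
by rewrite subUset LA (subset_trans RA) // subsetDl.
Qed.

Lemma card_pans p : #|lpan p :|: rpan p| = #|lpan p| + #|rpan p|.
Proof. by apply/eqP; rewrite (leq_card_setU _ _).2; exact: pans_disjoint. Qed.

(* The condition [R = set0] or [|F|] even rules out one f-candidate together
   with one r-candidate, which a single weighing cannot separate unless a coin
   known to be real is available. *)
Lemma identifiable_strategies w :
  (forall st F R,
     {in F, forall a, st a = FState} -> {in R, forall a, st a = RState} ->
     #|R| <= 1 -> R = set0 \/ ~~ odd #|F| ->
     #|F| + #|R| <= jacobsthal_nat w.+2 -> identifiable (F :|: R) st w) /\
  (forall st A,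
     {in A, forall a, st a = RState} -> #|A| <= jacobsthal_nat w.+1 ->
     identifiable A st w).
Proof.
elim: w => [|w [IHf IHr]].
  split=> [st F R _ _ _ _ le1|st A _ le1]; apply: identifiable_card_le1 => //.
  exact: leq_trans (leq_card_setU _ _) le1.
split=> [st F R stF stR R1 parity leJ|st A stA leJ].
  (* [jacobsthal_nat w.+1] is the number of r-candidates that the remaining [w] weighings can handle
     after an imbalance. *)
  pose x := minn (jacobsthal_nat w.+1) #|F|./2.
  have [|p [panF cL cR]] := @exists_weighing F x; first by rewrite /x; lia.
  apply: (@identifiable_weigh p) => o.
  have lighter (P : {set 'I_N}) : #|P| = x -> o <> Balance ->
    with_outcome p st (F :|: R) o \subset P ->
    identifiable (with_outcome p st (F :|: R) o) (state_after p st) w.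
    move=> cP oB subP; apply: IHr; first exact: with_outcome_lighter.
    by apply: leq_trans (subset_leq_card subP) _; rewrite cP geq_minl.
  case: o lighter => lighter; last 2 first.
  - apply: lighter cL _ _ => //; apply/subsetP => a; rewrite inE => /andP[_ /eqP].
    by rewrite /weigh_outcome; case: (st a) => //; do !case: ifP => //.
  - apply: lighter cR _ _ => //; apply/subsetP => a; rewrite inE => /andP[_ /eqP].
    by rewrite /weigh_outcome; case: (st a) => //; do !case: ifP => //.
  have panst a : a \in lpan p :|: rpan p -> st a = FState.
    by move=> ap; apply: stF; apply: (subsetP panF).
  have cF' : #|F :\: (lpan p :|: rpan p)| = #|F| - x.*2.
    by rewrite cardsDS // card_pans cL cR addnn.
  (* A balance clears every coin on the pans, as all of them would have acted fake. *)
  apply: (@identifiable_sub _ (F :\: (lpan p :|: rpan p) :|: R)).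
    apply/subsetP => a; rewrite inE => /andP[aFR bal].
    move: aFR; rewrite !in_setU in_setD => /orP[aF|->]; last by rewrite orbT.
    move/eqP: bal; rewrite aF /weigh_outcome (stF a aF) in_setU.
    by case: (a \in lpan p); case: (a \in rpan p).
  apply: IHf => // [a|a aR||].
  - by rewrite in_setD /state_after /weigh_state => /andP[/negbTE-> /stF].
  - rewrite /state_after /weigh_state; case: ifP => [/panst|_]; last exact: stR.
    by rewrite stR.
  - case: parity => [->|evF]; [by left|right].
    by rewrite cF'; lia.
  (* If [x] is the Jacobsthal number, the recurrence gives the bound; if [x] is half of [#|F|], the
     parity condition leaves at most one candidate. *)
  - rewrite cF'; move: leJ (jacobsthal_nat_gt0 w.+1).
    rewrite [jacobsthal_nat w.+3]jacobsthal_natSS /x.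
    case: parity => [->|evF]; rewrite ?cards0; lia.
(* The weighed coins become an even set of f-candidates, and at most one r-candidate stays off the
   scale. *)
have [|p [panA cL cR]] := @exists_weighing A #|A|./2; first by lia.
apply: (@identifiable_weigh p) => o; case: (o =P Balance) => [->|oB]; last first.
  apply: identifiable_card_le1; rewrite (_ : with_outcome _ _ _ _ = set0) ?cards0 //.
  apply/setP => a; rewrite !inE; apply/negP => /andP[aA].
  by rewrite (stA a aA) => /eqP /esym.
apply: (@identifiable_sub _ ((lpan p :|: rpan p) :|: (A :\: (lpan p :|: rpan p)))).
  apply/subsetP => a; rewrite inE => /andP[aA _].
  by rewrite in_setU in_setD aA andbT orbN.
have cA' : #|A :\: (lpan p :|: rpan p)| = #|A| - #|A|./2.*2.
  by rewrite cardsDS // card_pans cL cR addnn.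
have cp : #|lpan p :|: rpan p| = #|A|./2.*2 by rewrite card_pans cL cR addnn.
apply: IHf => [a ap|a|||].
- by rewrite /state_after /weigh_state ap stA //; apply: (subsetP panA).
- by rewrite in_setD /state_after /weigh_state => /andP[/negbTE-> /stA].
- by rewrite cA'; lia.
- by right; rewrite cp odd_double.
- by rewrite cp cA'; lia.
Qed.

End Weighings.

Lemma findable_within_identifiable N st w :
  findable_within st N w <-> identifiable [set: 'I_N] (fun _ => st) w.
Proof.
split=> -[s [inj sz]]; exists s; split=> //.
- by move=> a b _ _; apply: inj.
- by move=> a b; apply: inj; rewrite inE.
- by move=> a; apply: sz; rewrite inE.
Qed.

Lemma findable_withinF N w :
  findable_within FState N w <-> N <= jacobsthal_nat w.+2.
Proof.
rewrite findable_within_identifiable; split=> [[s /card_identifies[]]|leN].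
  by rewrite cardsT card_ord.
rewrite -(setU0 [set: _]); apply: (identifiable_strategies N w).1 => //.
- by move=> a; rewrite inE.
- by rewrite cards0.
- by left.
- by rewrite cardsT card_ord cards0 addn0.
Qed.

Lemma findable_withinR N w :
  findable_within RState N w <-> N <= jacobsthal_nat w.+1.
Proof.
rewrite findable_within_identifiable; split=> [[s /card_identifies[_]]|leN].
  by rewrite cardsT card_ord; apply.
by apply: (identifiable_strategies N w).2; rewrite ?cardsT ?card_ord.
Qed.

Lemma findable_within_mono st N w w' :
  w <= w' -> findable_within st N w -> findable_within st N w'.
Proof.
move=> le_w [s [inj sz]]; exists s; split=> // a.
exact: leq_trans (sz a) le_w.
Qed.

(** By monotonicity in the budget, failure at [w] excludes every smaller budget too. *)
Lemma least_weighingsS st N w :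
  findable_within st N w.+1 -> ~ findable_within st N w ->
  least_weighings st N w.+1.
Proof.
move=> fw nfw; split=> // w' fw'; rewrite ltnNge; apply/negP => le_w'.
exact: nfw (findable_within_mono le_w' fw').
Qed.

Theorem theorem1 (w : nat) (hw : (1 <= w)%N) :
  (forall N : nat,
      (jacobsthal w.+1 < N%:R)%R -> (N%:R <= jacobsthal w.+2)%R -> f_eq N w) /\
  (forall N : nat,
      (jacobsthal w < N%:R)%R -> (N%:R <= jacobsthal w.+1)%R -> r_eq N w).
Proof.
(* With [w] written as a successor, the strict lower bound on [N] says that one weighing fewer
   fails. *)
case: w hw => // w _; split=> N; rewrite !jacobsthal_natE ltr_nat ler_nat.
  move=> gtN leN; apply: least_weighingsS; rewrite findable_withinF //.
  by apply/negP; rewrite -ltnNge.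
move=> gtN leN; apply: least_weighingsS; rewrite findable_withinR //.
by apply/negP; rewrite -ltnNge.
Qed.
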